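(* The subvariety of the variety $\mathbb{UMTL}$ of UMTL-algebras determined by the equation $$x\vee \neg x=1$$ is term-equivalent to the variety $\mathbb{MBA}$ of monadic Boolean algebras.
   Context: An MTL-algebra is a structure $(L,\wedge,\vee,\odot,\rightarrow,0,1)$ such that $(L,\wedge,\vee,0,1)$ is a bounded lattice (with order $\le$), $(L,\odot,1)$ is a commutative monoid, $x\odot y\leq z$ iff $x\leq y\rightarrow z$, and $(x\rightarrow y)\vee(y\rightarrow x)=1$ for all $x,y,z\in L$. Negation is $\neg x=x\rightarrow 0$. A UMTL-algebra (MTL-algebra with a universal quantifier) is a structure $(L,\forall)=(L,\wedge,\vee,\odot,\rightarrow,0,1,\forall)$ where $(L,\wedge,\vee,\odot,\rightarrow,0,1)$ is an MTL-algebra and $\forall:L\to L$ is a unary operation satisfying, for all $x,y\in L$: (U1) $\forall x\leq x$; (U2) $\forall((x\rightarrow \forall y)\rightarrow \forall y)=(\forall x\rightarrow \forall y)\rightarrow \forall y$; (U3) $\forall(\forall x\rightarrow y)=\forall x\rightarrow\forall y$. The variety of UMTL-algebras is denoted $\mathbb{UMTL}$. A monadic Boolean algebra is an algebra $(L,\wedge,\vee,\neg,\exists,0,1)$ such that $(L,\wedge,\vee,\neg,0,1)$ is a Boolean algebra and $\exists$ satisfies: $\exists 0=0$; $x\leq \exists x$; $\exists(x\wedge \exists y)=\exists x\wedge\exists y$. The variety of monadic Boolean algebras is denoted $\mathbb{MBA}$. *)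

(* Defs.v *)
From mathcomp Require Import all_boot.

Set Implicit Arguments.
Unset Strict Implicit.
Unset Printing Implicit Defensive.

Record signature := Signature { symbol : Type; arity : symbol -> nat }.

(** Carriers are arbitrary types with Leibniz equality: the order and algebra
    structures of MathComp would force them to be [choiceType]s. *)
Record algebra (S : signature) := Algebra {
  carrier :> Type;
  op : forall f : symbol S, (arity f).-tuple carrier -> carrier }.

Inductive term (S : signature) (n : nat) : Type :=
| Var of 'I_n
| App (f : symbol S) of 'I_(arity f) -> term S n.

Arguments Var {S n} _.
Arguments App {S n} f _.

Fixpoint eval (S : signature) (A : algebra S) (n : nat) (e : n.-tuple A)
    (t : term S n) : A :=
  match t with
  | Var i => tnth e i
  | App f ts => op [tuple eval e (ts i) | i < arity f]
  end.

Definition satisfies (S : signature) (A : algebra S) (n : nat)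
    (s t : term S n) : Prop :=
  forall e : n.-tuple A, eval e s = eval e t.

Definition subvariety (S : signature) (K : algebra S -> Prop) (n : nat)
    (s t : term S n) : algebra S -> Prop :=
  fun A => K A /\ satisfies A s t.

(** A translation interprets each basic operation symbol of [S'] as an
    [S]-term in as many variables as its arity. *)
Definition translation (S S' : signature) : Type :=
  forall f : symbol S', term S (arity f).

Definition derived (S S' : signature) (tau : translation S S')
    (A : algebra S) : algebra S' :=
  @Algebra S' A (fun f e => eval e (tau f)).

(** The round trips are equalities of algebras on the same carrier, expressed
    operation by operation. *)
Definition term_equivalent (S S' : signature)
    (K : algebra S -> Prop) (K' : algebra S' -> Prop) : Prop :=
  exists (tau : translation S S') (sigma : translation S' S),
  [/\ forall A, K A -> K' (derived tau A),
      forall B, K' B -> K (derived sigma B),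
      forall A, K A -> forall (f : symbol S) (e : (arity f).-tuple A),
        @op S (derived sigma (derived tau A)) f e = @op S A f e
    & forall B, K' B -> forall (f : symbol S') (e : (arity f).-tuple B),
        @op S' (derived tau (derived sigma B)) f e = @op S' B f e].

Record is_bounded_lattice (T : Type) (meet join : T -> T -> T) (zero one : T)
    : Prop := IsBoundedLattice {
  meet_comm : commutative meet;
  meet_assoc : associative meet;
  join_comm : commutative join;
  join_assoc : associative join;
  meet_absorb : forall x y, meet x (join x y) = x;
  join_absorb : forall x y, join x (meet x y) = x;
  meet_zero : forall x, meet zero x = zero;
  meet_one : forall x, meet x one = x }.

Record is_MTL (T : Type) (meet join odot imp : T -> T -> T) (zero one : T)
    : Prop := IsMTL {
  MTL_lattice : is_bounded_lattice meet join zero one;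
  odot_assoc : associative odot;
  odot_comm : commutative odot;
  odot_one : left_id one odot;
  residuation : forall x y z,
    meet (odot x y) z = odot x y <-> meet x (imp y z) = x;
  prelinearity : forall x y, join (imp x y) (imp y x) = one }.

Record is_UMTL (T : Type) (meet join odot imp : T -> T -> T) (zero one : T)
    (all : T -> T) : Prop := IsUMTL {
  UMTL_MTL : is_MTL meet join odot imp zero one;
  UMTL_U1 : forall x, meet (all x) x = all x;
  UMTL_U2 : forall x y,
    all (imp (imp x (all y)) (all y)) = imp (imp (all x) (all y)) (all y);
  UMTL_U3 : forall x y, all (imp (all x) y) = imp (all x) (all y) }.

Record is_boolean (T : Type) (meet join : T -> T -> T) (neg : T -> T)
    (zero one : T) : Prop := IsBoolean {
  boolean_lattice : is_bounded_lattice meet join zero one;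
  boolean_distr : left_distributive meet join;
  boolean_meetN : forall x, meet x (neg x) = zero;
  boolean_joinN : forall x, join x (neg x) = one }.

Record is_MBA (T : Type) (meet join : T -> T -> T) (neg ex : T -> T)
    (zero one : T) : Prop := IsMBA {
  MBA_boolean : is_boolean meet join neg zero one;
  MBA_ex0 : ex zero = zero;
  MBA_le_ex : forall x, meet x (ex x) = x;
  MBA_ex_meet : forall x y, ex (meet x (ex y)) = meet (ex x) (ex y) }.

Variant UMTL_symbol :=
  U_meet | U_join | U_odot | U_imp | U_zero | U_one | U_all.

Definition UMTL_sig : signature :=
  @Signature UMTL_symbol (fun f => match f with
    | U_meet | U_join | U_odot | U_imp => 2
    | U_zero | U_one => 0
    | U_all => 1
    end).

Definition UMTL (A : algebra UMTL_sig) : Prop :=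
  is_UMTL (fun x y => @op _ A U_meet [tuple x; y])
          (fun x y => @op _ A U_join [tuple x; y])
          (fun x y => @op _ A U_odot [tuple x; y])
          (fun x y => @op _ A U_imp [tuple x; y])
          (@op _ A U_zero [tuple])
          (@op _ A U_one [tuple])
          (fun x => @op _ A U_all [tuple x]).

Variant MBA_symbol := M_meet | M_join | M_neg | M_ex | M_zero | M_one.

Definition MBA_sig : signature :=
  @Signature MBA_symbol (fun f => match f with
    | M_meet | M_join => 2
    | M_neg | M_ex => 1
    | M_zero | M_one => 0
    end).

Definition MBA (B : algebra MBA_sig) : Prop :=
  is_MBA (fun x y => @op _ B M_meet [tuple x; y])
         (fun x y => @op _ B M_join [tuple x; y])
         (fun x => @op _ B M_neg [tuple x])
         (fun x => @op _ B M_ex [tuple x])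
         (@op _ B M_zero [tuple])
         (@op _ B M_one [tuple]).

Definition U_zero_term (n : nat) : term UMTL_sig n :=
  @App UMTL_sig n U_zero (tnth [tuple]).
Definition U_one_term (n : nat) : term UMTL_sig n :=
  @App UMTL_sig n U_one (tnth [tuple]).
Definition U_join_term (n : nat) (s t : term UMTL_sig n) : term UMTL_sig n :=
  @App UMTL_sig n U_join (tnth [tuple s; t]).
Definition U_neg_term (n : nat) (t : term UMTL_sig n) : term UMTL_sig n :=
  @App UMTL_sig n U_imp (tnth [tuple t; U_zero_term n]).

Definition excluded_middle_term : term UMTL_sig 1 :=
  U_join_term (Var ord0) (U_neg_term (Var ord0)).

(* Main.v *)
From mathcomp Require Import all_boot.
Require Import Defs.

Set Implicit Arguments.
Unset Strict Implicit.
Unset Printing Implicit Defensive.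

(** Excluded middle collapses an MTL-algebra to a Boolean algebra.  Since
    product with a fixed element is residuated, [x] and [neg x] both lie below
    [imp x (odot x x)] (the second because [odot (neg x) x = zero]); their join
    is [one], so [x <= odot x x].  Hence the product is idempotent, so it is
    the meet ([em_odotE]); the lattice is then distributive with [neg] as
    complement ([em_boolean]), and [imp x y] is the Boolean implication
    [join (neg x) y] ([em_impE]).

    The quantifiers are exchanged by De Morgan duality,
    [ex x = neg (all (neg x))] and [all x = neg (ex (neg x))].  In a Boolean
    algebra [imp (imp x d) d = join x d], so (U2) reads
    [all (join x (all y)) = join (all x) (all y)], which is the dual of
    [ex (meet x (ex y)) = meet (ex x) (ex y)], and (U1) is the dual of
    [x <= ex x].  The equation [ex zero = zero] is dual to [all one = one],
    which is (U3) at [zero] ([all_one]).  Conversely (U3) follows from the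
    monadic axioms because complements of closed elements are closed,
    [ex (neg (ex x)) = neg (ex x)] ([ex_neg_ex]): this puts (U3) in the same
    form as (U2).  These two arguments are [em_UMTL_MBA] and [MBA_UMTL].

    The terms realizing the equivalence are the ones just displayed; the round
    trips hold by double negation together with [em_odotE] and [em_impE]. *)

(** * Bounded lattices *)

Section BoundedLattice.

Variables (T : Type) (meet join : T -> T -> T) (zero one : T).
Hypothesis latT : is_bounded_lattice meet join zero one.

Local Notation "x `&` y" := (meet x y) (at level 48, left associativity).
Local Notation "x `|` y" := (join x y) (at level 52, left associativity).
Local Notation "x <== y" := (meet x y = x) (at level 70, no associativity).

Let meetC := meet_comm latT.
Let meetA := meet_assoc latT.
Let joinC := join_comm latT.

Lemma le_refl x : x <== x.
Proof. by rewrite -{2}[x](join_absorb latT x x) (meet_absorb latT). Qed.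

Lemma le_antisym x y : x <== y -> y <== x -> x = y.
Proof. by move=> xy yx; rewrite -xy meetC. Qed.

Lemma le_trans y x z : x <== y -> y <== z -> x <== z.
Proof. by move=> xy yz; rewrite -xy -meetA yz. Qed.

Lemma meet_lel x y : x `&` y <== x.
Proof. by rewrite meetC meetA le_refl. Qed.

Lemma meet_ler x y : x `&` y <== y.
Proof. by rewrite -meetA le_refl. Qed.

Lemma le_meet z x y : z <== x -> z <== y -> z <== x `&` y.
Proof. by move=> zx zy; rewrite meetA zx zy. Qed.

Lemma le_joinl x y : x <== x `|` y.
Proof. exact: meet_absorb latT _ _. Qed.

Lemma le_joinr x y : y <== x `|` y.
Proof. by rewrite joinC le_joinl. Qed.

Lemma le_join_eq x y : x <== y -> x `|` y = y.
Proof. by move=> <-; rewrite joinC meetC (join_absorb latT). Qed.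

Lemma join_le x y z : x <== z -> y <== z -> x `|` y <== z.
Proof.
move=> /le_join_eq xz /le_join_eq yz.
by rewrite -{1}xz -yz (join_assoc latT) le_joinl.
Qed.

Lemma le_zero x : zero <== x.
Proof. exact: meet_zero latT _. Qed.

Lemma le_one x : x <== one.
Proof. exact: meet_one latT _. Qed.

Lemma join_zero x : x `|` zero = x.
Proof. by rewrite joinC; apply: le_join_eq; exact: le_zero. Qed.

End BoundedLattice.

(** * Boolean algebras *)

Section Boolean.

Variables (T : Type) (meet join : T -> T -> T) (neg : T -> T) (zero one : T).
Hypothesis boolT : is_boolean meet join neg zero one.

Local Notation "x `&` y" := (meet x y) (at level 48, left associativity).
Local Notation "x `|` y" := (join x y) (at level 52, left associativity).
Local Notation "x <== y" := (meet x y = x) (at level 70, no associativity).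

Let latT := boolean_lattice boolT.
Let meetC := meet_comm latT.
Let joinC := join_comm latT.

(** The Boolean case of residuation; the inequalities below about [neg] are
    obtained from it with [z = zero]. *)
Lemma boolean_residuation x y z : x `&` y <== z <-> x <== neg y `|` z.
Proof.
split=> xyz.
  have xE : (y `&` x) `|` (neg y `&` x) = x.
    rewrite -(boolean_distr boolT) (boolean_joinN boolT) meetC.
    exact: (meet_one latT).
  rewrite -xE; apply: (join_le latT).
    rewrite [y `&` x]meetC; apply: (le_trans latT xyz); exact: (le_joinr latT).
  apply: (le_trans latT (meet_lel latT _ _)); exact: (le_joinl latT).
have le_yz : (neg y `|` z) `&` y <== z.
  rewrite (boolean_distr boolT) [neg y `&` y]meetC (boolean_meetN boolT).
  rewrite [zero `|` _]joinC (join_zero latT); exact: (meet_lel latT).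
apply: (le_trans latT _ le_yz).
apply: (le_meet latT); last exact: (meet_ler latT).
exact: (le_trans latT (meet_lel latT _ _) xyz).
Qed.

(** Boolean complements are unique because the lattice is distributive; double
    negation is an instance. *)
Lemma neg_unique x y : x `&` y = zero -> x `|` y = one -> y = neg x.
Proof.
move=> xy0 xy1; apply: (le_antisym latT).
  rewrite -[neg x](join_zero latT); apply/boolean_residuation.
  by rewrite [y `&` x]meetC xy0 (le_refl latT).
have nxE : y `&` neg x = neg x.
  rewrite -[RHS](meet_one latT) -xy1 [RHS]meetC (boolean_distr boolT).
  by rewrite (boolean_meetN boolT) [RHS]joinC (join_zero latT).
by rewrite -nxE; exact: (meet_lel latT).
Qed.

Lemma negK : involutive neg.
Proof.
move=> x; apply/esym/neg_unique; first by rewrite meetC (boolean_meetN boolT).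
by rewrite joinC (boolean_joinN boolT).
Qed.

Lemma neg_le x y : x <== y -> neg y <== neg x.
Proof.
move=> xy; rewrite -[neg x](join_zero latT); apply/boolean_residuation.
have -> : neg y `&` x = zero; last exact: (le_refl latT).
rewrite -xy meetC -(meet_assoc latT) (boolean_meetN boolT) meetC.
exact: (meet_zero latT).
Qed.

Lemma neg_join x y : neg (x `|` y) = neg x `&` neg y.
Proof.
apply: (le_antisym latT).
  apply: (le_meet latT); apply: neg_le.
    exact: (le_joinl latT).
  exact: (le_joinr latT).
rewrite -[neg (_ `|` _)](join_zero latT).
apply: (proj1 (boolean_residuation _ _ _)).
rewrite [_ `&` (x `|` y)]meetC (boolean_distr boolT); apply: (join_le latT).
  rewrite (meet_assoc latT) (boolean_meetN boolT) (meet_zero latT).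
  exact: (le_refl latT).
rewrite [neg x `&` _]meetC (meet_assoc latT) (boolean_meetN boolT).
rewrite (meet_zero latT).
exact: (le_refl latT).
Qed.

Lemma neg_meet x y : neg (x `&` y) = neg x `|` neg y.
Proof. by rewrite -[RHS]negK neg_join !negK. Qed.

(** The dual of the distributive law, by De Morgan. *)
Lemma join_distr x y z : (x `&` y) `|` z = (x `|` z) `&` (y `|` z).
Proof.
rewrite -[LHS]negK neg_join [neg (x `&` y)]neg_meet (boolean_distr boolT).
by rewrite neg_join !neg_meet !negK.
Qed.

(** Turns the nested implications of (U2) into a join. *)
Lemma boolean_imp_imp x y : neg (neg x `|` y) `|` y = x `|` y.
Proof.
rewrite neg_join negK join_distr [neg y `|` y]joinC (boolean_joinN boolT).
exact: (meet_one latT).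
Qed.

Lemma boolean_MTL :
  is_MTL meet join meet (fun x y => neg x `|` y) zero one.
Proof.
split=> //; first exact: (meet_assoc latT).
- by move=> x; rewrite meetC (meet_one latT).
- exact: boolean_residuation.
move=> x y; apply: (le_antisym latT); first exact: (le_one latT).
rewrite -(boolean_joinN boolT x); apply: (join_le latT).
  apply: (le_trans latT (le_joinr latT (neg y) x)); exact: (le_joinr latT).
apply: (le_trans latT (le_joinl latT (neg x) y)); exact: (le_joinl latT).
Qed.

End Boolean.

(** * Monadic Boolean algebras *)

Section MonadicBoolean.

Variables (T : Type) (meet join : T -> T -> T) (neg ex : T -> T) (zero one : T).
Hypothesis mbaT : is_MBA meet join neg ex zero one.

Local Notation "x `&` y" := (meet x y) (at level 48, left associativity).
Local Notation "x `|` y" := (join x y) (at level 52, left associativity).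
Local Notation "x <== y" := (meet x y = x) (at level 70, no associativity).

Let boolT := MBA_boolean mbaT.
Let latT := boolean_lattice boolT.
Let meetC := meet_comm latT.
Let joinC := join_comm latT.

(** [neg (ex x)] is disjoint from [ex x], and the third monadic axiom carries
    this disjointness to [ex (neg (ex x))] and [ex x]. *)
Lemma ex_neg_ex x : ex (neg (ex x)) = neg (ex x).
Proof.
apply: (le_antisym latT); last exact: MBA_le_ex mbaT _.
rewrite -[X in _ <== X](join_zero latT); apply/(boolean_residuation boolT).
rewrite -(MBA_ex_meet mbaT) [neg _ `&` _]meetC (boolean_meetN boolT).
by rewrite (MBA_ex0 mbaT) (le_refl latT).
Qed.

(** (U1) and (U2) dualize the axioms of [ex]; for (U3), [ex_neg_ex] exhibits
    [neg (ex (neg x))] as a value of [ex], so that the axiom on [ex] of a meet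
    applies again. *)
Lemma MBA_UMTL :
  is_UMTL meet join meet (fun x y => neg x `|` y) zero one
          (fun x => neg (ex (neg x))).
Proof.
split; first exact: boolean_MTL boolT.
- move=> x; rewrite -{2}[x](negK boolT); apply: (neg_le boolT).
  exact: MBA_le_ex mbaT _.
- move=> x y; rewrite !(boolean_imp_imp boolT) (neg_join boolT) (negK boolT).
  by rewrite (MBA_ex_meet mbaT) (neg_meet boolT).
move=> x y; rewrite (negK boolT) (neg_join boolT) -[neg (ex (neg x))]ex_neg_ex.
rewrite [_ `&` neg y]meetC (MBA_ex_meet mbaT) ex_neg_ex (neg_meet boolT).
by rewrite (negK boolT) joinC.
Qed.

End MonadicBoolean.

(** * MTL-algebras with excluded middle *)

Section ExcludedMiddleMTL.

Variables (T : Type) (meet join odot imp : T -> T -> T) (zero one : T).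
Hypothesis mtlT : is_MTL meet join odot imp zero one.

Local Notation "x `&` y" := (meet x y) (at level 48, left associativity).
Local Notation "x `|` y" := (join x y) (at level 52, left associativity).
Local Notation "x <== y" := (meet x y = x) (at level 70, no associativity).
Local Notation neg x := (imp x zero).

Let latT := MTL_lattice mtlT.
Let meetC := meet_comm latT.
Let joinC := join_comm latT.
Let odotC := odot_comm mtlT.

Lemma odot_lel x y : odot x y <== x.
Proof.
rewrite odotC; apply/(residuation mtlT)/(le_trans latT (le_one latT y)).
by apply/(residuation mtlT); rewrite (odot_one mtlT) (le_refl latT).
Qed.

Lemma odot_ler x y : odot x y <== y.
Proof. by rewrite odotC; exact: odot_lel. Qed.

Lemma odot_mono x y z : x <== y -> odot x z <== odot y z.
Proof.
move=> xy; apply/(residuation mtlT)/(le_trans latT xy)/(residuation mtlT).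
exact: (le_refl latT).
Qed.

Lemma odot_neg x : odot (neg x) x = zero.
Proof.
apply: (le_antisym latT); last exact: (le_zero latT).
by apply/(residuation mtlT); exact: (le_refl latT).
Qed.

Hypothesis em : forall x, x `|` neg x = one.

(** The one place where excluded middle acts on the product: both [x] and
    [neg x] lie below [imp x (odot x x)]. *)
Lemma em_odot_idem x : odot x x = x.
Proof.
apply: (le_antisym latT); first exact: odot_lel.
(* Write x as odot one x, so that residuation leaves one on the left and the
   join of x and neg x can take its place. *)
rewrite -{1 4}[x](odot_one mtlT); apply/(residuation mtlT).
rewrite -(em x); apply: (join_le latT); apply/(residuation mtlT).
  exact: (le_refl latT).
rewrite odot_neg; exact: (le_zero latT).
Qed.

(** The product always lies below the meet; idempotence and monotonicity give
    [meet x y = odot (meet x y) (meet x y) <= odot x y]. *)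
Lemma em_odotE x y : odot x y = x `&` y.
Proof.
apply: (le_antisym latT).
  apply: (le_meet latT); [exact: odot_lel | exact: odot_ler].
rewrite -(em_odot_idem (x `&` y)).
apply: (le_trans latT (odot_mono _ (meet_lel latT x y))).
rewrite odotC [odot x y]odotC; apply: odot_mono; exact: (meet_ler latT).
Qed.

(** Distributivity holds because meet, being the product, has a residual. *)
Lemma em_boolean : is_boolean meet join (fun x => neg x) zero one.
Proof.
split=> // [x y z|x]; last by rewrite meetC -em_odotE odot_neg.
apply: (le_antisym latT).
  rewrite -[(x `|` y) `&` z]em_odotE; apply/(residuation mtlT)/(join_le latT).
    apply/(residuation mtlT); rewrite em_odotE; exact: (le_joinl latT).
  apply/(residuation mtlT); rewrite em_odotE; exact: (le_joinr latT).
rewrite -[(x `|` y) `&` z]em_odotE -[x `&` z]em_odotE -[y `&` z]em_odotE.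
apply: (join_le latT); apply: odot_mono.
  exact: (le_joinl latT).
exact: (le_joinr latT).
Qed.

(** Both sides are residuals of the meet. *)
Lemma em_impE x y : imp x y = neg x `|` y.
Proof.
apply: (le_antisym latT).
  apply/(boolean_residuation em_boolean); rewrite -[imp x y `&` x]em_odotE.
  by apply/(residuation mtlT); exact: (le_refl latT).
apply/(residuation mtlT); rewrite em_odotE.
by apply/(boolean_residuation em_boolean); exact: (le_refl latT).
Qed.

Lemma em_imp_imp x y : imp (imp x y) y = x `|` y.
Proof.
by rewrite [LHS]em_impE [imp x y]em_impE (boolean_imp_imp em_boolean).
Qed.

Variable all : T -> T.
Hypothesis umtlT : is_UMTL meet join odot imp zero one all.

(** This is (U3) at [zero], since [all zero = zero] by (U1) and
    [imp zero zero = one]. *)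
Lemma all_one : all one = one.
Proof.
have all0 : all zero = zero.
  apply: (le_antisym latT); last exact: (le_zero latT).
  exact: UMTL_U1 umtlT _.
have imp0 x : imp zero x = one.
  apply: (le_antisym latT); first exact: (le_one latT).
  by apply/(residuation mtlT); rewrite (odot_one mtlT); exact: (le_zero latT).
by have := UMTL_U3 umtlT zero zero; rewrite all0 !imp0.
Qed.

(** The axioms of [ex] are the De Morgan duals of [all_one], (U1) and (U2). *)
Lemma em_UMTL_MBA :
  is_MBA meet join (fun x => neg x) (fun x => neg (all (neg x))) zero one.
Proof.
have boolT := em_boolean; have negK := negK boolT.
split=> //.
- have neg0 : neg zero = one by rewrite -[LHS](join_zero latT) joinC em.
  by rewrite neg0 all_one -neg0 negK.
- move=> x; rewrite -{1 3}[x]negK; apply: (neg_le boolT).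
  exact: UMTL_U1 umtlT _.
move=> x y; rewrite (neg_meet boolT) -(neg_join boolT) negK.
have := UMTL_U2 umtlT (neg x) (neg y).
by rewrite !em_imp_imp => ->.
Qed.

End ExcludedMiddleMTL.

(** * Evaluation of terms and the two translations *)

(** The operations of a derived algebra are term evaluations, which agree with
    the intended operations only pointwise; this lemma and the next one
    transport the axioms along such pointwise equalities, avoiding functional
    extensionality. *)
Lemma is_MBA_ext (T : Type) (meet meet' join join' : T -> T -> T)
    (neg neg' ex ex' : T -> T) (zero zero' one one' : T) :
    meet =2 meet' -> join =2 join' -> neg =1 neg' -> ex =1 ex' ->
    zero = zero' -> one = one' ->
  is_MBA meet join neg ex zero one -> is_MBA meet' join' neg' ex' zero' one'.
Proof.
move=> meetE joinE negE exE <- <- [[[*] *] *].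
by split; first (split; first split); move=> *;
  rewrite -?meetE -?joinE -?negE -?exE.
Qed.

Lemma is_UMTL_ext (T : Type)
    (meet meet' join join' odot odot' imp imp' : T -> T -> T)
    (zero zero' one one' : T) (all all' : T -> T) :
    meet =2 meet' -> join =2 join' -> odot =2 odot' -> imp =2 imp' ->
    zero = zero' -> one = one' -> all =1 all' ->
  is_UMTL meet join odot imp zero one all ->
  is_UMTL meet' join' odot' imp' zero' one' all'.
Proof.
move=> meetE joinE odotE impE <- <- allE [[[*] *] *].
by split; first (split; first split); move=> *;
  rewrite -?meetE -?joinE -?odotE -?impE -?allE.
Qed.

Lemma eval_App_Var (S : signature) (A : algebra S) (f : symbol S)
    (e : (arity f).-tuple A) :
  eval e (App f Var) = op e.
Proof. by congr op; apply: eq_from_tnth => i; rewrite tnth_mktuple. Qed.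

Lemma eval_App_tnth (S : signature) (A : algebra S) (n : nat) (e : n.-tuple A)
    (f : symbol S) (ts : (arity f).-tuple (term S n)) :
  eval e (App f (tnth ts)) = op (map_tuple (eval e) ts).
Proof.
by congr op; apply: eq_from_tnth => i; rewrite tnth_mktuple tnth_map.
Qed.

Lemma eval_U_zero (A : algebra UMTL_sig) (n : nat) (e : n.-tuple A) :
  eval e (U_zero_term n) = @op _ A U_zero [tuple].
Proof. by rewrite [LHS]eval_App_tnth; congr op; apply: val_inj. Qed.

Lemma eval_U_one (A : algebra UMTL_sig) (n : nat) (e : n.-tuple A) :
  eval e (U_one_term n) = @op _ A U_one [tuple].
Proof. by rewrite [LHS]eval_App_tnth; congr op; apply: val_inj. Qed.

Lemma eval_U_join (A : algebra UMTL_sig) (n : nat) (e : n.-tuple A)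
    (s t : term UMTL_sig n) :
  eval e (U_join_term s t) = @op _ A U_join [tuple eval e s; eval e t].
Proof. by rewrite [LHS]eval_App_tnth; congr op; apply: val_inj. Qed.

Lemma eval_U_neg (A : algebra UMTL_sig) (n : nat) (e : n.-tuple A)
    (t : term UMTL_sig n) :
  eval e (U_neg_term t) =
  @op _ A U_imp [tuple eval e t; @op _ A U_zero [tuple]].
Proof.
rewrite -(eval_U_zero e) [LHS]eval_App_tnth.
by congr op; apply: val_inj.
Qed.

Lemma eval_U_all (A : algebra UMTL_sig) (n : nat) (e : n.-tuple A)
    (t : term UMTL_sig n) :
  eval e (@App UMTL_sig n U_all (tnth [tuple t])) =
  @op _ A U_all [tuple eval e t].
Proof. by rewrite eval_App_tnth; congr op; apply: val_inj. Qed.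

Definition M_neg_term (n : nat) (t : term MBA_sig n) : term MBA_sig n :=
  @App MBA_sig n M_neg (tnth [tuple t]).

Lemma eval_M_neg (B : algebra MBA_sig) (n : nat) (e : n.-tuple B)
    (t : term MBA_sig n) :
  eval e (M_neg_term t) = @op _ B M_neg [tuple eval e t].
Proof. by rewrite eval_App_tnth; congr op; apply: val_inj. Qed.

Lemma eval_M_ex (B : algebra MBA_sig) (n : nat) (e : n.-tuple B)
    (t : term MBA_sig n) :
  eval e (@App MBA_sig n M_ex (tnth [tuple t])) =
  @op _ B M_ex [tuple eval e t].
Proof. by rewrite eval_App_tnth; congr op; apply: val_inj. Qed.

Lemma eval_M_join (B : algebra MBA_sig) (n : nat) (e : n.-tuple B)
    (s t : term MBA_sig n) :
  eval e (@App MBA_sig n M_join (tnth [tuple s; t])) =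
  @op _ B M_join [tuple eval e s; eval e t].
Proof. by rewrite eval_App_tnth; congr op; apply: val_inj. Qed.

Definition MBA_of_UMTL : translation UMTL_sig MBA_sig := fun f =>
  match f with
  | M_meet => @App UMTL_sig 2 U_meet Var
  | M_join => @App UMTL_sig 2 U_join Var
  | M_neg => U_neg_term (Var ord0)
  | M_ex => U_neg_term
      (@App UMTL_sig 1 U_all (tnth [tuple U_neg_term (Var ord0)]))
  | M_zero => @App UMTL_sig 0 U_zero Var
  | M_one => @App UMTL_sig 0 U_one Var
  end.

Definition UMTL_of_MBA : translation MBA_sig UMTL_sig := fun f =>
  match f with
  | U_meet | U_odot => @App MBA_sig 2 M_meet Var
  | U_join => @App MBA_sig 2 M_join Var
  | U_imp => @App MBA_sig 2 M_join
      (tnth [tuple M_neg_term (Var ord0); Var ord_max])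
  | U_zero => @App MBA_sig 0 M_zero Var
  | U_one => @App MBA_sig 0 M_one Var
  | U_all => M_neg_term
      (@App MBA_sig 1 M_ex (tnth [tuple M_neg_term (Var ord0)]))
  end.

(** * The derived algebras *)

Section DerivedOperations.

Variables (A : algebra UMTL_sig) (B : algebra MBA_sig).

Local Notation dA := (derived MBA_of_UMTL A).
Local Notation dB := (derived UMTL_of_MBA B).

Lemma derived_meetA x y :
  @op _ dA M_meet [tuple x; y] = @op _ A U_meet [tuple x; y].
Proof. exact: (@eval_App_Var UMTL_sig A U_meet). Qed.

Lemma derived_joinA x y :
  @op _ dA M_join [tuple x; y] = @op _ A U_join [tuple x; y].
Proof. exact: (@eval_App_Var UMTL_sig A U_join). Qed.

Lemma derived_zeroA : @op _ dA M_zero [tuple] = @op _ A U_zero [tuple].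
Proof. exact: (@eval_App_Var UMTL_sig A U_zero). Qed.

Lemma derived_oneA : @op _ dA M_one [tuple] = @op _ A U_one [tuple].
Proof. exact: (@eval_App_Var UMTL_sig A U_one). Qed.

Lemma derived_negA x :
  @op _ dA M_neg [tuple x] = @op _ A U_imp [tuple x; @op _ A U_zero [tuple]].
Proof. exact: eval_U_neg. Qed.

Lemma derived_exA x :
  @op _ dA M_ex [tuple x] =
  @op _ A U_imp [tuple @op _ A U_all [tuple @op _ A U_imp
    [tuple x; @op _ A U_zero [tuple]]]; @op _ A U_zero [tuple]].
Proof. by rewrite [LHS]eval_U_neg eval_U_all eval_U_neg. Qed.

Lemma derived_meetB x y :
  @op _ dB U_meet [tuple x; y] = @op _ B M_meet [tuple x; y].
Proof. exact: (@eval_App_Var MBA_sig B M_meet). Qed.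

Lemma derived_odotB x y :
  @op _ dB U_odot [tuple x; y] = @op _ B M_meet [tuple x; y].
Proof. exact: (@eval_App_Var MBA_sig B M_meet). Qed.

Lemma derived_joinB x y :
  @op _ dB U_join [tuple x; y] = @op _ B M_join [tuple x; y].
Proof. exact: (@eval_App_Var MBA_sig B M_join). Qed.

Lemma derived_zeroB : @op _ dB U_zero [tuple] = @op _ B M_zero [tuple].
Proof. exact: (@eval_App_Var MBA_sig B M_zero). Qed.

Lemma derived_oneB : @op _ dB U_one [tuple] = @op _ B M_one [tuple].
Proof. exact: (@eval_App_Var MBA_sig B M_one). Qed.

Lemma derived_impB x y :
  @op _ dB U_imp [tuple x; y] =
  @op _ B M_join [tuple @op _ B M_neg [tuple x]; y].
Proof. by rewrite [LHS]eval_M_join eval_M_neg. Qed.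

Lemma derived_allB x :
  @op _ dB U_all [tuple x] =
  @op _ B M_neg [tuple @op _ B M_ex [tuple @op _ B M_neg [tuple x]]].
Proof. by rewrite [LHS]eval_M_neg eval_M_ex eval_M_neg. Qed.

End DerivedOperations.

Lemma satisfies_excluded_middle (A : algebra UMTL_sig) :
  satisfies A excluded_middle_term (U_one_term 1) <->
  forall x : A, @op _ A U_join [tuple x; @op _ A U_imp
    [tuple x; @op _ A U_zero [tuple]]] = @op _ A U_one [tuple].
Proof.
split=> [em x|em e]; last by rewrite eval_U_join eval_U_neg eval_U_one em.
by have := em [tuple x]; rewrite eval_U_join eval_U_neg eval_U_one.
Qed.

(** * The term equivalence *)

Lemma tuple1_eta (T : Type) (e : 1.-tuple T) : e = [tuple tnth e ord0].
Proof. by apply: eq_from_tnth => i; rewrite ord1. Qed.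

Lemma tuple2_eta (T : Type) (e : 2.-tuple T) :
  e = [tuple tnth e ord0; tnth e ord_max].
Proof.
apply: eq_from_tnth => -[[|[|//]] i2]; rewrite [RHS]/tnth /=;
  by congr tnth; apply: val_inj.
Qed.

Lemma UMTL_derived (B : algebra MBA_sig) :
  MBA B -> subvariety UMTL excluded_middle_term (U_one_term 1)
    (derived UMTL_of_MBA B).
Proof.
move=> mbaB; split.
  apply: is_UMTL_ext (MBA_UMTL mbaB).
  - move=> x y; exact/esym/derived_meetB.
  - move=> x y; exact/esym/derived_joinB.
  - move=> x y; exact/esym/derived_odotB.
  - move=> x y; exact/esym/derived_impB.
  - exact/esym/derived_zeroB.
  - exact/esym/derived_oneB.
  move=> x; exact/esym/derived_allB.
apply/satisfies_excluded_middle => x.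
rewrite derived_joinB derived_impB derived_zeroB derived_oneB.
have boolB := MBA_boolean mbaB.
by rewrite (join_zero (boolean_lattice boolB)) (boolean_joinN boolB).
Qed.

Lemma MBA_derived (A : algebra UMTL_sig) :
  subvariety UMTL excluded_middle_term (U_one_term 1) A ->
  MBA (derived MBA_of_UMTL A).
Proof.
case=> umtlA /satisfies_excluded_middle em.
apply: is_MBA_ext (em_UMTL_MBA (UMTL_MTL umtlA) em umtlA).
- move=> x y; exact/esym/derived_meetA.
- move=> x y; exact/esym/derived_joinA.
- move=> x; exact/esym/derived_negA.
- move=> x; exact/esym/derived_exA.
- exact/esym/derived_zeroA.
exact/esym/derived_oneA.
Qed.

Lemma UMTL_roundtrip (A : algebra UMTL_sig) :
  subvariety UMTL excluded_middle_term (U_one_term 1) A ->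
  forall (f : symbol UMTL_sig) (e : (arity f).-tuple A),
    @op _ (derived UMTL_of_MBA (derived MBA_of_UMTL A)) f e = @op _ A f e.
Proof.
case=> umtlA /satisfies_excluded_middle em; have mtlA := UMTL_MTL umtlA.
have boolA := em_boolean mtlA em.
case=> e.
- by rewrite [e]tuple2_eta derived_meetB derived_meetA.
- by rewrite [e]tuple2_eta derived_joinB derived_joinA.
- by rewrite [e]tuple2_eta derived_odotB derived_meetA (em_odotE mtlA em).
- rewrite [e]tuple2_eta derived_impB derived_joinA derived_negA.
  by rewrite [RHS](em_impE mtlA em).
- by rewrite [e]tuple0 derived_zeroB derived_zeroA.
- by rewrite [e]tuple0 derived_oneB derived_oneA.
rewrite [e]tuple1_eta derived_allB !derived_negA derived_exA.
by rewrite !(negK boolA).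
Qed.

Lemma MBA_roundtrip (B : algebra MBA_sig) :
  MBA B ->
  forall (f : symbol MBA_sig) (e : (arity f).-tuple B),
    @op _ (derived MBA_of_UMTL (derived UMTL_of_MBA B)) f e = @op _ B f e.
Proof.
move=> mbaB; have boolB := MBA_boolean mbaB; have latB := boolean_lattice boolB.
case=> e.
- by rewrite [e]tuple2_eta derived_meetA derived_meetB.
- by rewrite [e]tuple2_eta derived_joinA derived_joinB.
- rewrite [e]tuple1_eta derived_negA derived_impB derived_zeroB.
  exact: (join_zero latB).
- rewrite [e]tuple1_eta derived_exA !derived_impB !derived_zeroB derived_allB.
  by rewrite !(join_zero latB) !(negK boolB).
- by rewrite [e]tuple0 derived_zeroA derived_zeroB.
by rewrite [e]tuple0 derived_oneA derived_oneB.
Qed.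

Theorem theorem3p6 :
  term_equivalent (subvariety UMTL excluded_middle_term (U_one_term 1)) MBA.
Proof.
exists MBA_of_UMTL, UMTL_of_MBA; split.
- exact: MBA_derived.
- exact: UMTL_derived.
- exact: UMTL_roundtrip.
exact: MBA_roundtrip.
Qed.
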